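(* A locally connected normal space has a one-point normal connectification if and only if it has no compact component.
   Context: Conventions: ''normal'' means $T_4$, i.e. Hausdorff (equivalently, $T_1$) and such that any two disjoint closed sets can be separated by disjoint open sets. A space is locally connected if every point has a neighborhood base consisting of connected open sets. The components (also called connected components) of a space $X$ are the maximal connected subsets of $X$; they partition $X$ into pairwise disjoint non-empty closed subsets. A space $Y$ is called a one-point connectification of a space $X$ if $Y$ is connected, $Y$ contains $X$ as a dense subspace, and $Y\setminus X$ is a singleton. A one-point normal connectification of $X$ is a one-point connectification of $X$ that is a normal space. *)

(* Defs.v *)
From mathcomp Require Import all_boot all_order all_algebra.
From mathcomp Require Import all_classical all_reals all_analysis.

Set Implicit Arguments.
Unset Strict Implicit.
Unset Printing Implicit Defensive.

Local Open Scope classical_set_scope.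

(* The library predicate [normal_space] does not include any separation of
   points, hence the conjunct [hausdorff_space]. *)
Definition T4_space (X : topologicalType) : Prop :=
  hausdorff_space X /\ normal_space X.

Definition locally_connected_space (X : topologicalType) : Prop :=
  forall (x : X) (U : set X), nbhs x U ->
    exists V : set X, [/\ open V, V x, connected V & V `<=` U].

(* On an inhabited space the components are exactly the sets
   [connected_component setT x].  On the empty space [set0] is the unique
   maximal connected subset, since [set0] is connected for the library. *)
Definition is_component (X : topologicalType) (C : set X) : Prop :=
  connected C /\ forall D : set X, connected D -> C `<=` D -> D = C.

Definition topological_embedding (X Y : topologicalType) (f : X -> Y) : Prop :=
  injective f /\
  forall A : set X, open A <-> exists2 B : set Y, open B & A = f @^-1` B.

(* "[Y] contains [X] as a subspace" is read up to a homeomorphism of [X] onto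
   its image. *)
Definition one_point_connectification (X Y : topologicalType) : Prop :=
  connected [set: Y] /\
  exists f : X -> Y,
    [/\ topological_embedding f, dense (range f)
      & exists p : Y, ~` range f = [set p]].

Definition one_point_normal_connectification (X Y : topologicalType) : Prop :=
  one_point_connectification X Y /\ T4_space Y.

(* Main.v *)
Require Import Defs.
From HB Require Import structures.
From mathcomp Require Import all_boot all_order all_algebra.
From mathcomp Require Import all_classical all_reals all_analysis.

Set Implicit Arguments.
Unset Strict Implicit.
Unset Printing Implicit Defensive.

Local Open Scope classical_set_scope.

(** If [Y] is a connectification of [X], a compact component [C] of [X] is
compact, hence closed, in [Y]; it is also open in [X], hence in [Y], which
contradicts the connectedness of [Y].

Conversely, if no component is compact, choose on each component [C] a proper
filter without cluster point in [C]. The sets which contain, for every [C], the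
closure of a member of the filter of [C] form a filter [G] on [X] that has a
base of closed sets, because the components are clopen and form a locally finite
family. The trace neighborhoods of the new point are the members of [G]. *)

(** * Normality as separation of disjoint closed sets *)

Lemma normal_open_separation (T : topologicalType) (A B : set T) :
  normal_space T -> closed A -> closed B -> A `&` B = set0 ->
  exists U V, [/\ open U, open V, A `<=` U, B `<=` V & U `&` V = set0].
Proof.
move=> nT cA cB AB0.
have [|V /set_nbhsP[U [oU AU UV]] VB] := nT A cA (~` B).
  apply/set_nbhsP; exists (~` B); split => //; first exact: closed_openC.
  exact/disjoints_subset.
(* [closure V] misses [B], so its complement is an open set around [B], disjoint from [U] because
   [U] lies in [V]. *)
exists U, (~` closure V); split => //.
- exact/closed_openC/closed_closure.
- by move=> x Bx /VB.
- apply/disjoints_subset; rewrite setCK.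
  exact: subset_trans UV (@subset_closure _ _).
Qed.

Lemma open_separation_normal (T : topologicalType) :
  (forall A B : set T, closed A -> closed B -> A `&` B = set0 ->
    exists U V, [/\ open U, open V, A `<=` U, B `<=` V & U `&` V = set0]) ->
  normal_space T.
Proof.
move=> sepT A cA B /set_nbhsP[C [oC AC CB]].
have [|U [V [oU oV AU CV UV0]]] := sepT A (~` C) cA (open_closedC oC).
  by apply/disjoints_subset; rewrite setCK.
exists U; first by apply/set_nbhsP; exists U; split.
move=> x clUx; apply: CB; apply: contrapT => nCx; have Vx := CV x nCx.
have [y] := clUx V (open_nbhs_nbhs (conj oV Vx)).
by rewrite UV0.
Qed.

(** * Components of a space *)

Section components.
Variable X : topologicalType.
Implicit Types C D : set X.

Lemma is_component_subset C D :
  is_component C -> connected D -> C `&` D !=set0 -> D `<=` C.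
Proof.
move=> [cC maxC] cD CD.
rewrite -(maxC (C `|` D)); [exact: subsetUr|exact: connectedU|exact: subsetUl].
Qed.

Lemma is_component_connected_component (x : X) :
  is_component (connected_component setT x).
Proof.
split=> [|D cD sD]; first exact: component_connected.
apply/seteqP; split => //; apply: connected_component_max => //.
exact/sD/connected_component_refl.
Qed.

Lemma is_component_eq C D :
  is_component C -> is_component D -> C `&` D !=set0 -> C = D.
Proof.
move=> cC cD CD; apply/seteqP; split.
  by apply: is_component_subset => //; [case: cC|rewrite setIC].
by apply: is_component_subset => //; case: cD.
Qed.

Lemma is_component_closed C : is_component C -> closed C.
Proof.
move=> [cC maxC]; rewrite -(maxC (closure C)); first exact: closed_closure.
- exact: connected_closure.
- exact: subset_closure.
Qed.

(** A connected neighborhood of a point of [C] is absorbed by [C], by maximality. *)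
Lemma is_component_open C :
  locally_connected_space X -> is_component C -> open C.
Proof.
move=> lcX cC; rewrite openE => x Cx.
have [V [oV Vx cV _]] := lcX x setT filterT.
have VC : V `<=` C by apply: is_component_subset => //; exists x.
by apply: filterS VC _; apply: open_nbhs_nbhs.
Qed.

(** The point [x] excludes the empty space, where [set0] is a component; otherwise the connected set
    [[set x]] shows that [set0] is not maximal. *)
Lemma is_component_nonempty (x : X) C : is_component C -> C !=set0.
Proof.
move=> [_ maxC]; apply/set0P/eqP => C0.
have : [set x] = C by apply: maxC; [exact: connected1|rewrite C0].
by rewrite C0 => /seteqP[/(_ x erefl)].
Qed.

End components.

(** The filter is recorded in the type so that each filter carries its own topology on [option X];
    [None] is the new point. *)
Definition one_point_extension (X : topologicalType) (G : set_system X)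
  (FG : Filter G) : Type := option X.

(** * Topology of the one-point extension along a filter *)

Section one_point_extension.
Context {X : topologicalType} {G : set_system X} {FG : Filter G}.

Local Notation Y := (one_point_extension FG).
Local Notation i := (Some : X -> Y).

HB.instance Definition _ := Choice.copy Y (option X).

Definition extension_open (U : set Y) : Prop :=
  open (i @^-1` U) /\ (U None -> G (i @^-1` U)).

Let extension_openT : extension_open setT.
Proof. by split=> [|_]; [exact: openT|exact: filterT]. Qed.

Let extension_openI : setI_closed extension_open.
Proof.
move=> U V [oU GU] [oV GV]; split; first exact: openI.
by move=> [/GU ? /GV ?]; exact: filterI.
Qed.

Let extension_open_bigU (I : Type) (f : I -> set Y) :
  (forall j, extension_open (f j)) -> extension_open (\bigcup_j f j).
Proof.
move=> of_; split.
  by rewrite preimage_bigcup; apply: bigcup_open => j _; case: (of_ j).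
move=> [j _ /(of_ j).2]; apply: filterS => x fx.
by exists j.
Qed.

HB.instance Definition _ := isOpenTopological.Build Y
  extension_openT extension_openI extension_open_bigU.

Lemma extension_openP (U : set Y) :
  open U <-> open (i @^-1` U) /\ (U None -> G (i @^-1` U)).
Proof. by []. Qed.

Lemma extension_open_image (A : set X) : open A -> open (i @` A).
Proof.
move=> oA; apply/extension_openP; split; last by case.
suff -> : i @^-1` (i @` A) = A by [].
by apply/seteqP; split=> [x [y Ay [<-]]|x Ax] //; exists x.
Qed.

Lemma extension_embedding : topological_embedding i.
Proof.
split=> [x y []//|A]; split=> [oA|[B /extension_openP[oB _] ->]] //.
exists (i @` A); first exact: extension_open_image.
by apply/seteqP; split=> [x Ax|x [y Ay [<-]]] //; exists x.
Qed.

Lemma extension_closed (A : set Y) : closed A -> closed (i @^-1` A).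
Proof. by move=> /closed_openC[oA _]; rewrite -openC. Qed.

Lemma extension_filterC (A : set Y) :
  closed A -> ~ A None -> G (~` (i @^-1` A)).
Proof. by move=> /closed_openC[_ GA] /GA. Qed.

Lemma extension_dense : ~ G set0 -> dense (range i).
Proof.
move=> G0 O [[x|] Ox] /extension_openP[_ GO]; first by exists (Some x); split.
have : i @^-1` O !=set0.
  by apply/set0P/eqP => O0; apply: G0; rewrite -O0; exact: GO.
by move=> [x Oix]; exists (Some x); split.
Qed.

(** Every member of [G] meets [C], so the new point is in the closure of the image of [C]. These
    connected closures therefore all lie in the component of [None]. *)
Lemma extension_connected :
  (forall x, exists C, [/\ connected C, C x & forall U, G U -> C `&` U !=set0]) ->
  connected [set: Y].
Proof.
move=> HC; have -> : [set: Y] = connected_component setT (None : Y).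
  apply/seteqP; split=> // -[x|] _; last exact: connected_component_refl.
  have [C [cC Cx GC]] := HC x.
  apply: (@connected_component_max _ _ (closure (i @` C))) => //.
  - move=> V; rewrite nbhsE => -[U [/extension_openP[_ GU] UN] UV].
    by have [y [Cy Uy]] := GC _ (GU UN); exists (Some y); split; [exists y|exact: UV].
  - apply/connected_closure/connected_continuous_connected => //.
    by apply/continuous_subspaceT/continuousP => U /extension_openP[].
  - by apply: subset_closure; exists x.
exact: component_connected.
Qed.

Lemma extension_closed1 :
  T4_space X -> (forall x, G (~` [set x])) -> forall y : Y, closed [set y].
Proof.
move=> [hX _] Gx [x|]; rewrite -openC; apply/extension_openP; split => //.
- have -> : i @^-1` (~` [set i x]) = ~` [set x].
    by apply/seteqP; split=> y /= xy; [move=> yx; apply: xy; rewrite yx|case].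
  by apply/closed_openC/accessible_closed_set1/hausdorff_accessible.
- by move=> _; apply: filterS (Gx x) => y /= xy [].
- have -> : i @^-1` (~` [set (None : Y)]) = setT by apply/seteqP; split.
  exact: openT.
- by move=> /(_ erefl).
Qed.

Hypothesis closed_base : forall U, G U -> exists2 V, G V & closure V `<=` U.

(** Some [W] in [G] has its closure disjoint from [A]. Normality of [X] separates the trace of [A]
    from that of [B] together with [closure W]; the second open set contains [W], so it stays open
    once the new point is added to it. *)
Let extension_separation_infty (A B : set Y) : T4_space X ->
    closed A -> closed B -> A `&` B = set0 -> ~ A None ->
  exists U V, [/\ open U, open V, A `<=` U, B `<=` V & U `&` V = set0].
Proof.
move=> [_ nX] cA cB AB0 AN.
have [W GW WA] := closed_base (extension_filterC cA AN).
have [| U [V [oU oV AU BV UV0]]] := normal_open_separation nX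
    (extension_closed cA) (closedU (extension_closed cB) (@closed_closure _ W)).
  rewrite setIUr; apply/seteqP; split=> // x [[Ax Bx]|[Ax /WA]] //.
  by rewrite -[set0]/(i @^-1` set0) -AB0.
exists (i @` U), (i @` V `|` [set (None : Y)]); split.
- exact: extension_open_image.
- have iV : i @^-1` (i @` V `|` [set (None : Y)]) = V.
    by apply/seteqP; split=> [x [[y Vy [<-]]|]|x Vx] //; left; exists x.
  apply/extension_openP; rewrite iV; split=> // _.
  by apply: filterS GW => x /subset_closure Wx; apply: BV; right.
- by move=> [x|] // Ax; exists x => //; exact: AU.
- by move=> [x|] Bx; [left; exists x => //; apply: BV; left|right].
- apply/seteqP; split=> // _ [[x Ux <-] [[y Vy [yx]]|//]].
  by move: UV0 => /seteqP[+ _] => /(_ x); apply; split=> //; rewrite -yx.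
Qed.

Lemma extension_T4 : T4_space X -> (forall x, G (~` [set x])) -> T4_space Y.
Proof.
move=> T4X Gx.
have sepY (A B : set Y) : closed A -> closed B -> A `&` B = set0 ->
    exists U V, [/\ open U, open V, A `<=` U, B `<=` V & U `&` V = set0].
  (* Disjoint sets cannot both contain the new point, so up to exchanging them [A] avoids it. *)
  move=> cA cB AB0; have [AN|] := pselect (A None); last exact: extension_separation_infty.
  have BN : ~ B None.
    by move=> BN; have : (A `&` B) None by []; rewrite AB0.
  rewrite setIC in AB0.
  have [U [V [oU oV BU AV UV0]]] := extension_separation_infty T4X cB cA AB0 BN.
  by exists V, U; split => //; rewrite setIC.
split; last exact: open_separation_normal.
rewrite open_hausdorff => x y /eqP xy.
have [||| U [V [oU oV xU yV UV0]]] := sepY [set x] [set y].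
- exact: extension_closed1.
- exact: extension_closed1.
- by apply/seteqP; split=> // z [-> /xy].
exists (U, V); first by split; rewrite inE; [exact: xU|exact: yV].
by split => //=; exact/eqP.
Qed.

End one_point_extension.

(** * The trace filter of the new point *)

Section end_filter.
Variables (X : topologicalType) (F : set X -> set_system X).
Hypothesis lcX : locally_connected_space X.
Hypothesis F_proper : forall C, is_component C -> ProperFilter (F C).
Hypothesis F_component : forall C, is_component C -> F C C.
Hypothesis F_cluster : forall C, is_component C -> C `&` cluster (F C) = set0.

Definition end_filter : set_system X :=
  [set U | forall C, is_component C -> exists2 A, F C A & closure A `<=` U].

Lemma end_filter_filter : Filter end_filter.
Proof.
split=> [C cC|U V GU GV C cC|U V UV GU C cC].
- by exists C => //; exact: F_component.
- have [A FA AU] := GU C cC; have [B FB BV] := GV C cC.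
  have FF := F_proper cC; exists (A `&` B); first exact: filterI.
  apply: subset_trans (@closureI _ A B) _.
  exact: setISS.
- by have [A FA AU] := GU C cC; exists A => //; exact: subset_trans UV.
Qed.

Lemma end_filter_meets C U : is_component C -> end_filter U -> C `&` U !=set0.
Proof.
move=> cC /(_ C cC)[A FA AU]; have FF := F_proper cC.
have [x [Cx Ax]] := filter_ex (filterI (F_component cC) FA).
by exists x; split => //; exact/AU/subset_closure.
Qed.

Lemma end_filterC1 (x : X) : end_filter (~` [set x]).
Proof.
move=> C cC; have [Cx|nCx] := pselect (C x).
  have : ~ cluster (F C) x.
    by move=> clx; have : (C `&` cluster (F C)) x by []; rewrite F_cluster.
  (* Cluster points are the points common to the closures of all members, so some member has a
     closure that misses [x]. *)
  rewrite clusterE => /existsNP[A /not_implyP[FA nAx]].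
  by exists A => // y Ay yx; apply: nAx; rewrite -yx.
(* When [x] is outside [C], the closed set [C] itself is a suitable member. *)
exists C; first exact: F_component.
have /closure_id <- := is_component_closed cC.
by move=> y Cy yx; apply: nCx; rewrite -yx.
Qed.

(** The union of the pieces [closure (A C)] cut down to [C] serves as [V]. Near a point of an open
    component only the piece of that component is visible, so taking the closure of the union does
    not leave [U]. *)
Lemma end_filter_closed_base U :
  end_filter U -> exists2 V, end_filter V & closure V `<=` U.
Proof.
move=> GU.
have /choice[A HA] : forall C, exists A,
    is_component C -> F C A /\ closure A `<=` U.
  move=> C; have [cC|] := pselect (is_component C); last by exists set0.
  by have [A FA AU] := GU C cC; exists A.
exists (\bigcup_(C in @is_component X) (closure (A C) `&` C)).
  move=> C cC; have FF := F_proper cC; exists (A C `&` C).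
    by apply: filterI; [case: (HA C cC)|exact: F_component].
  move=> x /closureI[Ax]; have /closure_id <- := is_component_closed cC.
  by exists C.
move=> x clx; have cC := is_component_connected_component x.
set C := connected_component _ _ in cC; have Cx : C x by exact: connected_component_refl.
apply: (HA C cC).2; apply: closed_closure => B Bx.
have nC : nbhs x C by apply: open_nbhs_nbhs; split => //; exact: is_component_open.
have [y [[D cD [Ay Dy]] [By Cy]]] := clx _ (filterI Bx nC).
by exists y; split => //; rewrite (@is_component_eq _ C D) //; exists y.
Qed.

End end_filter.

(** * Compact components and connectifications *)

Lemma noncompact_filter (X : topologicalType) (C : set X) : ~ compact C ->
  exists F : set_system X, [/\ ProperFilter F, F C & C `&` cluster F = set0].
Proof.
move=> /existsNP[F /not_implyP[PF /not_implyP[FC nC]]].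
by exists F; split => //; apply: contrapT => /eqP/set0P.
Qed.

Lemma connectification_no_compact_component (X Y : topologicalType) (C : set X) :
  locally_connected_space X -> hausdorff_space Y ->
  one_point_connectification X Y -> is_component C -> ~ compact C.
Proof.
move=> lcX hY [conY [f [[f_inj f_open] f_dense [p fp]]]] cC kC.
have np : ~ range f p by have : (~` range f) p by rewrite fp.
(* Density of the range in the inhabited space [Y] gives a point of [X], so that [C] is not
   empty. *)
have [_ [_ [x _ _]]] := f_dense setT (ex_intro _ p I) openT.
have f_cts : continuous f.
  by apply/continuousP => B oB; apply/f_open; exists B.
have cfC : closed (f @` C).
  by apply: compact_closed => //; apply: continuous_compact => //; exact: continuous_subspaceT.
have ofC : open (f @` C).
  have /f_open[B oB CB] := is_component_open lcX cC.
  (* The range is open, being the complement of the closed point [p]; an open set of [X] thus has an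
     open image. *)
  have -> : f @` C = B `&` range f.
    rewrite CB; apply/seteqP; split=> [_ [z Bz <-]|z [Bz [w _ fw]]].
      by split => //; exists z.
    by exists w => //=; rewrite fw.
  apply: openI => //; rewrite -closedC fp.
  exact/accessible_closed_set1/hausdorff_accessible.
have fCT : f @` C = setT.
  apply: conY; last 2 first.
  - by exists (f @` C); rewrite ?setTI.
  - by exists (f @` C); rewrite ?setTI.
  have [y Cy] := is_component_nonempty x cC.
  by exists (f y); exists y.
by apply: np; have : setT p by []; rewrite -fCT => -[y _ <-]; exists y.
Qed.

Theorem theorem4 (X : topologicalType)
    (hlc : locally_connected_space X) (hT4 : T4_space X) :
  (exists Y : topologicalType, one_point_normal_connectification X Y) <->
  ~ (exists C : set X, is_component C /\ compact C).
Proof.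
split=> [[Y [cY [hY _]]] [C [cC kC]]|nK].
  exact: (connectification_no_compact_component hlc hY cY cC).
have /choice[F HF] : forall C, exists F : set_system X, is_component C ->
    [/\ ProperFilter F, F C & C `&` cluster F = set0].
  move=> C; have [cC|] := pselect (is_component C); last by exists setT.
  have [|F PF] := @noncompact_filter _ C; first by move=> kC; apply: nK; exists C.
  by exists F.
have F_proper C : is_component C -> ProperFilter (F C) by case/HF.
have F_component C : is_component C -> F C C by case/HF.
have F_cluster C : is_component C -> C `&` cluster (F C) = set0 by case/HF.
have FG := end_filter_filter F_proper F_component.
(* In the empty space [set0] would be a compact component, which is excluded. *)
have [x _] : [set: X] !=set0.
  apply/set0P/eqP => X0; apply: nK; exists set0; split; last exact: compact0.
  by split=> [|D _ _]; [exact: connected0|rewrite -subset0 -X0].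
exists (one_point_extension FG); split; last first.
  apply: extension_T4 => //.
  - exact: end_filter_closed_base.
  - exact: end_filterC1.
split.
  apply: extension_connected => y; exists (connected_component setT y).
  have cC := is_component_connected_component y; split.
  - by case: cC.
  - exact: connected_component_refl.
  - by move=> U; exact: end_filter_meets.
exists Some; split; first exact: extension_embedding.
  (* The filter is proper, since its members meet the component of [x]. *)
  apply: extension_dense => G0.
  have cC := is_component_connected_component x.
  by have [z []] := end_filter_meets F_proper F_component cC G0.
exists None; apply/seteqP; split=> [[y|//] /=|_ -> []//].
by case; exists y.
Qed.
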